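(* If $G=A*_CB$ is an amalgamated free product in which $A$, $B$ and $C$ are finitely generated free groups, then $G*\mathbb{Z}$ admits a finite complete rewriting system.
   Context: A rewriting system is a pair $(X,\mathcal{R})$ with $X$ a finite set and $\mathcal{R}\subseteq X^*\times X^*$, where $X^*$ is the free monoid on $X$. Write $x\to_{\mathcal{R}}y$ if $x=x_1ux_2$, $y=x_1vx_2$ for some $(u,v)\in\mathcal{R}$, and let $\to^*_{\mathcal{R}}$ be the reflexive transitive closure. The system is finite if $X$ and $\mathcal{R}$ are finite; terminating if there is no infinite chain $x_0\to_{\mathcal{R}}x_1\to_{\mathcal{R}}\cdots$; confluent if whenever $x\to^*_{\mathcal{R}}y$ and $x\to^*_{\mathcal{R}}z$ there is $\bar x$ with $y\to^*_{\mathcal{R}}\bar x$ and $z\to^*_{\mathcal{R}}\bar x$; complete if terminating and confluent. A group $G$ admits a finite complete rewriting system if there is a finite complete rewriting system $(X,\mathcal{R})$ such that the monoid with presentation $\langle X\mid\mathcal{R}\rangle$ is isomorphic to $G$. *)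

(* Defs.v *)
From HB Require Import structures.
From Stdlib Require Import Relation_Operators.
From mathcomp Require Import all_boot ssralg ssrint.
From mathcomp Require Import generic_quotient.
From mathcomp Require Import boolp classical_sets cardinality.

Set Implicit Arguments.
Unset Strict Implicit.
Unset Printing Implicit Defensive.

Local Open Scope quotient_scope.
Local Open Scope group_scope.

Section Rewriting.
Variables (X : finType) (R : set (seq X * seq X)).

Definition rw_step (x y : seq X) : Prop :=
  exists x1 u v x2, [/\ R (u, v), x = x1 ++ u ++ x2 & y = x1 ++ v ++ x2].

Definition rw_steps : seq X -> seq X -> Prop := clos_refl_trans _ rw_step.

Definition rw_terminating : Prop :=
  ~ exists x : nat -> seq X, forall n, rw_step (x n) (x n.+1).

Definition rw_confluent : Prop :=
  forall x y z, rw_steps x y -> rw_steps x z ->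
  exists2 w, rw_steps y w & rw_steps z w.

Definition rw_complete : Prop := rw_terminating /\ rw_confluent.

(* The congruence on the free monoid [seq X] generated by [R]: since [rw_step]
   is already closed under left and right concatenation, its equivalence
   closure is the least congruence containing [R]. *)
Definition rw_congr : seq X -> seq X -> Prop := clos_refl_sym_trans _ rw_step.

Definition rw_congrb : rel (seq X) := fun x y => `[< rw_congr x y >].

Lemma rw_congrb_refl : reflexive rw_congrb.
Proof. by move=> x; apply/asboolP/rst_refl. Qed.

Lemma rw_congrb_sym : symmetric rw_congrb.
Proof. by move=> x y; apply/asboolP/asboolP => xy; apply: rst_sym. Qed.

Lemma rw_congrb_trans : transitive rw_congrb.
Proof.
by move=> y x z /asboolP xy /asboolP yz; apply/asboolP/(rst_trans _ _ _ y).
Qed.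

Canonical rw_congr_equiv : equiv_rel (seq X) :=
  EquivRel rw_congrb rw_congrb_refl rw_congrb_sym rw_congrb_trans.

(* The monoid with presentation < X | R >. *)
Definition presented_monoid : Type := {eq_quot rw_congrb}.
HB.instance Definition _ : Choice presented_monoid :=
  Choice.on presented_monoid.
HB.instance Definition _ : EqQuotient (seq X) rw_congrb presented_monoid :=
  EqQuotient.on presented_monoid.

Lemma rw_congr_ctx p q x y :
  rw_congr x y -> rw_congr (p ++ x ++ q) (p ++ y ++ q).
Proof.
elim=> {x y} [x y [x1 [u [v [x2 [Ruv -> ->]]]]]|x|x y _|x y z _ xy _ yz].
- apply: rst_step; exists (p ++ x1), u, v, (x2 ++ q).
  by rewrite !catA.
- exact: rst_refl.
- exact: rst_sym.
- exact: rst_trans xy yz.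
Qed.

Lemma rw_congr_cat x x' y y' :
  rw_congr x x' -> rw_congr y y' -> rw_congr (x ++ y) (x' ++ y').
Proof.
move=> xx' yy'; apply: (rst_trans _ _ _ (x' ++ y)).
  exact: (@rw_congr_ctx [::] y).
by have := @rw_congr_ctx x' [::] _ _ yy'; rewrite !cats0.
Qed.

Definition pm_class (w : seq X) : presented_monoid := \pi_presented_monoid w.

Definition pm_one : presented_monoid := pm_class [::].

Definition pm_mul (a b : presented_monoid) : presented_monoid :=
  pm_class (repr a ++ repr b).

Lemma pm_classP x y : pm_class x = pm_class y <-> rw_congr x y.
Proof.
split=> [/eqmodP/asboolP //|xy]; by apply/eqmodP/asboolP.
Qed.

Lemma pm_reprK a : pm_class (repr a) = a.
Proof. exact: reprK. Qed.

Lemma pm_repr_class x : rw_congr (repr (pm_class x)) x.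
Proof. by apply/pm_classP; rewrite pm_reprK. Qed.

Lemma pm_mul_class x y : pm_mul (pm_class x) (pm_class y) = pm_class (x ++ y).
Proof. by apply/pm_classP/rw_congr_cat; apply: pm_repr_class. Qed.

Lemma pm_mulA : associative pm_mul.
Proof.
move=> a b c; rewrite -(pm_reprK a) -(pm_reprK b) -(pm_reprK c).
by rewrite !pm_mul_class catA.
Qed.

Lemma pm_mul1 : left_id pm_one pm_mul.
Proof. by move=> a; rewrite -(pm_reprK a) pm_mul_class. Qed.

Lemma pm_mulr1 : right_id pm_one pm_mul.
Proof. by move=> a; rewrite -(pm_reprK a) pm_mul_class cats0. Qed.

HB.instance Definition _ :=
  isMonoid.Build presented_monoid pm_mulA pm_mul1 pm_mulr1.

End Rewriting.

Definition admits_finite_complete_rewriting (G : groupType) : Prop :=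
  exists (X : finType) (R : set (seq X * seq X)),
    [/\ finite_set R, rw_complete R &
        exists phi : presented_monoid R -> G,
          monoid_morphism phi /\ bijective phi].

(* The only subset containing [s] and closed under the group operations is the
   whole group. *)
Definition finitely_generated (G : groupType) : Prop :=
  exists s : seq G, forall S : set G,
    S 1 -> (forall x y, S x -> S y -> S (x * y)) ->
    (forall x, S x -> S x^-1) -> (forall x, x \in s -> S x) ->
    forall x, S x.

(* [G] is free on the family [b]. *)
Definition is_basis (G : groupType) (I : Type) (b : I -> G) : Prop :=
  forall (H : groupType) (u : I -> H),
    exists2 h : {multiplicative G -> H}, (forall i, h (b i) = u i) &
      forall h' : {multiplicative G -> H}, (forall i, h' (b i) = u i) -> h' =1 h.

Definition is_free_group (G : groupType) : Prop :=
  exists (I : Type) (b : I -> G), is_basis b.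

(* [G] is the pushout of the span [A <-f- C -g-> B] of monomorphisms, i.e. the
   amalgamated free product of [A] and [B] in which the copies [f C] and [g C]
   of [C] are identified. *)
Definition is_amalgam (A B C G : groupType)
    (f : {multiplicative C -> A}) (g : {multiplicative C -> B})
    (iA : {multiplicative A -> G}) (iB : {multiplicative B -> G}) : Prop :=
  [/\ injective f, injective g, (forall c, iA (f c) = iB (g c)) &
      forall (H : groupType)
             (u : {multiplicative A -> H}) (v : {multiplicative B -> H}),
        (forall c, u (f c) = v (g c)) ->
        exists2 h : {multiplicative G -> H},
          (forall a, h (iA a) = u a) /\ (forall b, h (iB b) = v b) &
          forall h' : {multiplicative G -> H},
            (forall a, h' (iA a) = u a) -> (forall b, h' (iB b) = v b) ->
            h' =1 h].

Definition is_free_product (A B P : groupType)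
    (jA : {multiplicative A -> P}) (jB : {multiplicative B -> P}) : Prop :=
  forall (H : groupType)
         (u : {multiplicative A -> H}) (v : {multiplicative B -> H}),
    exists2 h : {multiplicative P -> H},
      (forall a, h (jA a) = u a) /\ (forall b, h (jB b) = v b) &
      forall h' : {multiplicative P -> H},
        (forall a, h' (jA a) = u a) -> (forall b, h' (jB b) = v b) ->
        h' =1 h.

(* Main.v *)
(** Conjugating B by a generator t of the factor Z turns (A *_C B) * Z into the
    HNN extension of the free group F = A * B with stable letter t and
    relations t f(c) t^-1 = g(c).  Let U_+ = f(C) and U_- = g(C), and represent
    every coset U_e r by its shortlex-least reduced word.  Besides the free
    cancellations, take the rules t^e r x -> v t^e r', where r is a
    representative, x a letter, r x is reduced but not a representative,
    r x = u r' with r' the representative of U_e r x, and v in U_{-e}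
    corresponds to u in U_e.  The word r x is replaced by a shortlex-smaller
    one, while only factors to the left of t^e may grow, so comparing the
    factors from right to left gives termination.  These rules are finite in
    number: r is a prefix of the reduced word r x r'^-1 of U_e, and modulo U_e
    such a prefix is a prefix of one of finitely many generators of U_e.
    Finally F and t act on the right on the HNN normal forms; every word
    rewrites to the normal form which it produces from the trivial one, and the
    rules do not change this action, whence confluence and the faithfulness of
    the presentation. *)
Require Import Defs.
From HB Require Import structures.
From Stdlib Require Import Relation_Operators.
From mathcomp Require Import all_boot ssralg ssrint.
From mathcomp Require Import boolp classical_sets cardinality.

Set Implicit Arguments.
Unset Strict Implicit.
Unset Printing Implicit Defensive.

Local Open Scope group_scope.

Lemma hom1 (G H : groupType) (h : {multiplicative G -> H}) : h 1 = 1.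
Proof. by apply: (mulgI (h 1)); rewrite -gmulfM !mulg1. Qed.

Lemma homV (G H : groupType) (h : {multiplicative G -> H}) :
  {morph h : x / x^-1}.
Proof. by move=> x; apply/esym/mulg1_eq; rewrite -gmulfM mulgV hom1. Qed.

(** * Free groups *)

Section ReducedWords.
Variable I : choiceType.
Local Notation letter := (I * bool)%type.
Implicit Types (x y : letter) (u v w : seq letter).

Definition linv x : letter := (x.1, ~~ x.2).

Lemma linvK : involutive linv.
Proof. by case=> i b; rewrite /linv /= negbK. Qed.

Definition reduced : pred (seq letter) := sorted (fun x y => y != linv x).

Definition cons_red x w :=
  if w is y :: w' then if y == linv x then w' else x :: w else [:: x].

Definition red w := foldr cons_red [::] w.

Definition winv w := rev (map linv w).

Lemma reduced_behead x w : reduced (x :: w) -> reduced w.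
Proof. exact: path_sorted. Qed.

Lemma cons_red_reduced x w : reduced w -> reduced (cons_red x w).
Proof.
case: w => //= y w; case: ifP => [_ /path_sorted //|/negbT nyx w_red].
by rewrite /= nyx.
Qed.

Lemma foldr_red_reduced w u : reduced w -> reduced (foldr cons_red w u).
Proof. by move=> w_red; elim: u => //= x u; apply: cons_red_reduced. Qed.

Lemma red_reduced u : reduced (red u).
Proof. exact: foldr_red_reduced. Qed.

Lemma cons_redK x w : reduced w -> cons_red (linv x) (cons_red x w) = w.
Proof.
case: w => [|y w] /=; first by rewrite linvK eqxx.
case: eqP => [->|_]; last by rewrite /= linvK eqxx.
by case: w => //= z w /andP[/negPf-> _].
Qed.

Lemma cons_redVK x w : reduced w -> cons_red x (cons_red (linv x) w) = w.
Proof. by move=> w_red; rewrite -{1}(linvK x) cons_redK. Qed.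

Lemma cons_red_id x w : reduced (x :: w) -> cons_red x w = x :: w.
Proof. by case: w => //= y w /andP[/negPf-> _]. Qed.

Lemma red_id w : reduced w -> red w = w.
Proof.
elim: w => //= x w IHw xw_red.
by rewrite IHw ?(reduced_behead xw_red)// cons_red_id.
Qed.

(** By [cons_redVK] a cancelling pair of letters acts trivially on reduced words, so reducing the
    acting word changes nothing. Associativity of the group law rests on this. *)
Lemma foldr_red w u :
  reduced w -> foldr cons_red w (red u) = foldr cons_red w u.
Proof.
move=> w_red; elim: u => //= x u <-.
case: (red u) => //= y v; case: eqP => [->|//].
by rewrite cons_redVK// foldr_red_reduced.
Qed.

Lemma red_cat u v : red (u ++ v) = foldr cons_red (red v) u.
Proof. exact: foldr_cat. Qed.

Lemma red_catl u v : red (red u ++ v) = red (u ++ v).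
Proof. by rewrite !red_cat foldr_red// red_reduced. Qed.

Lemma red_catr u v : red (u ++ red v) = red (u ++ v).
Proof. by rewrite !red_cat (red_id (red_reduced v)). Qed.

Lemma winvK : involutive winv.
Proof. by move=> w; rewrite /winv map_rev revK mapK//; apply: linvK. Qed.

Lemma winv_cat u v : winv (u ++ v) = winv v ++ winv u.
Proof. by rewrite /winv map_cat rev_cat. Qed.

Lemma red_winvr w : red (w ++ winv w) = [::].
Proof.
elim: w => //= x w IHw.
rewrite /winv map_cons rev_cons -cats1 catA -red_catl IHw /=.
by rewrite eqxx.
Qed.

Lemma winv_reduced w : reduced w -> reduced (winv w).
Proof.
rewrite /reduced /winv rev_sorted sorted_map.
by apply: sub_sorted => x y /=; rewrite linvK eq_sym.
Qed.

Lemma reduced_cat u x w :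
  reduced (rcons u x) -> reduced (x :: w) -> reduced (rcons u x ++ w).
Proof.
rewrite /reduced; case: u => [|y u] //=.
by rewrite cat_path last_rcons => -> ->.
Qed.

Lemma reduced_catl u w : reduced (u ++ w) -> reduced u.
Proof.
by rewrite /reduced; case: u => //= x u; rewrite cat_path => /andP[].
Qed.

(** When [x] cancels the head of [red w], the prefix of length [i] of the result comes from the
    prefix of length [i.+1] of [red w], and putting [x] back in front cancels that head again. *)
Lemma take_red w i : exists j, red (take i (red w)) = red (take j w).
Proof.
elim: w i => [|x w IHw] i; first by exists 0%N.
rewrite [red (x :: w)]/=.
have [->|i_gt0] := posnP i; first by exists 0%N; rewrite !take0.
case def_w: (red w) (red_reduced w) => [|y v] w_red /=.
  by case: i i_gt0 => // i _; exists 1%N; rewrite /= take0.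
case: eqP => [def_y|_].
  have [j] := IHw i.+1; rewrite def_w => def_j.
  exists j.+1; rewrite /= -[red (take j w)]def_j /=.
  by rewrite def_y cons_redVK// red_reduced.
case: i i_gt0 => // i _.
have [j] := IHw i; rewrite def_w => def_j.
by exists j.+1; rewrite /= -[red (take j w)]def_j.
Qed.

End ReducedWords.

(** Elements are the reduced words themselves, not classes of words, so that prefixes and the
    shortlex order can be read off directly. *)
Definition freeg (I : choiceType) := {w : seq (I * bool) | reduced w}.

Section FreeGroup.
Variable I : choiceType.
Local Notation F := (freeg I).
Implicit Types (f g : F).

HB.instance Definition _ := Choice.on F.

Definition fword (w : seq (I * bool)) : F := exist _ (red w) (red_reduced w).

(* A variant of [val] which is not unfolded by simplification. *)
Definition fseq f : seq (I * bool) := val f.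

Lemma fseq_inj : injective fseq.
Proof. exact: val_inj. Qed.

Lemma fseq_reduced f : reduced (fseq f).
Proof. exact: valP f. Qed.

Lemma fseq_fword w : fseq (fword w) = red w.
Proof. by []. Qed.

Lemma fwordP f : fword (fseq f) = f.
Proof. by apply: fseq_inj; rewrite fseq_fword red_id ?fseq_reduced. Qed.

Lemma eq_fword u v : red u = red v -> fword u = fword v.
Proof. by move=> uv; apply: fseq_inj. Qed.

Definition fone : F := fword [::].
Definition fmul f g := fword (fseq f ++ fseq g).
Definition finv f := fword (winv (fseq f)).

Lemma fmulA : associative fmul.
Proof.
by move=> f g h; apply: fseq_inj; rewrite !fseq_fword red_catl red_catr catA.
Qed.

Lemma fmul1 : left_id fone fmul.
Proof. by move=> f; rewrite /fmul /= fwordP. Qed.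

Lemma fmulr1 : right_id fone fmul.
Proof. by move=> f; rewrite /fmul /= cats0 fwordP. Qed.

Lemma fmulV : left_inverse fone finv fmul.
Proof.
move=> f; apply: fseq_inj; rewrite !fseq_fword red_catl -{2}(winvK (fseq f)).
exact: red_winvr.
Qed.

Lemma fmulrV : right_inverse fone finv fmul.
Proof.
by move=> f; apply: fseq_inj; rewrite !fseq_fword red_catr red_winvr.
Qed.

HB.instance Definition _ :=
  isGroup.Build F fmulA fmul1 fmulr1 fmulV fmulrV.

Definition fletter (x : I * bool) : F := fword [:: x].

Lemma fseq_letter x : fseq (fletter x) = [:: x].
Proof. by []. Qed.

Lemma fseq_mul f g : fseq (f * g) = red (fseq f ++ fseq g).
Proof. by []. Qed.

Lemma fseq_one : fseq (1 : F) = [::].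
Proof. by []. Qed.

Lemma fseq_inv f : fseq f^-1 = winv (fseq f).
Proof. by rewrite fseq_fword red_id// winv_reduced// fseq_reduced. Qed.

Lemma fword_cat u v : fword (u ++ v) = fword u * fword v.
Proof. by apply: fseq_inj; rewrite fseq_mul !fseq_fword red_catl red_catr. Qed.

Lemma fword_rcons u x : fword (rcons u x) = fword u * fletter x.
Proof. by rewrite -cats1 fword_cat. Qed.

Lemma fletterV x : fletter (linv x) = (fletter x)^-1.
Proof. by apply: fseq_inj; rewrite fseq_inv. Qed.

Section Eval.
Variables (H : groupType) (u : I -> H).

Definition leval (x : I * bool) : H := if x.2 then u x.1 else (u x.1)^-1.

Definition weval (w : seq (I * bool)) : H :=
  foldr (fun x h => leval x * h) 1 w.

Lemma weval_cat v w : weval (v ++ w) = weval v * weval w.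
Proof. by elim: v => /= [|x v ->]; rewrite ?mul1g ?mulgA. Qed.

Lemma levalV x : leval (linv x) = (leval x)^-1.
Proof. by case: x => i [] //=; rewrite /leval /= invgK. Qed.

Lemma weval_red w : weval (red w) = weval w.
Proof.
elim: w => //= x w <-; case: (red w) => //= y v.
by case: eqP => //= ->; rewrite levalV mulVKg.
Qed.

Definition feval f := weval (fseq f).

Lemma fevalM : {morph feval : f g / f * g}.
Proof. by move=> f g; rewrite /feval fseq_mul weval_red weval_cat. Qed.

HB.instance Definition _ := isMultiplicative.Build F H feval fevalM.

Lemma feval_fletter x : feval (fletter x) = leval x.
Proof. by rewrite /feval /= mulg1. Qed.

End Eval.

Lemma eq_hom_free (H : groupType) (h h' : {multiplicative F -> H}) :
  (forall i, h (fletter (i, true)) = h' (fletter (i, true))) -> h =1 h'.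
Proof.
move=> hh' f; rewrite -(fwordP f); elim: (fseq f) => [|x w IHw].
  by rewrite (_ : fword _ = 1)// !hom1.
rewrite -cat1s fword_cat !gmulfM {}IHw; congr (_ * _).
case: x => i []; first exact: hh'.
by rewrite -[fword _]/(fletter (linv (i, true))) fletterV !homV hh'.
Qed.

End FreeGroup.

(** * HNN extensions of free groups *)

Section Code.
Variable L : finType.
Implicit Types (x : L) (v w : seq L).

(* Reading a word as a numeral with nonzero digits in base [#|L| + 1] orders
   words by length first and then lexicographically. *)
Definition code_push (a : nat) x : nat := (a * #|L|.+1 + (enum_rank x).+1)%N.

Definition code w : nat := foldl code_push 0%N w.

Lemma code_push_mono a a' x : (a < a' -> code_push a x < code_push a' x)%N.
Proof. by move=> lt_aa'; rewrite ltn_add2r ltn_pmul2r. Qed.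

Lemma code_push_gt a x : (a < code_push a x)%N.
Proof.
by rewrite /code_push addnS ltnS (leq_trans _ (leq_addr _ _))// leq_pmulr.
Qed.

Lemma code_push_inj a a' x x' :
  code_push a x = code_push a' x' -> a = a' /\ x = x'.
Proof.
have ltK (y : L) : ((enum_rank y).+1 < #|L|.+1)%N by rewrite ltnS ltn_ord.
move=> eq_push; split.
  have /(congr1 (divn^~ #|L|.+1)) := eq_push.
  by rewrite /= !divnMDl// !divn_small// !addn0.
have /(congr1 (modn^~ #|L|.+1)) := eq_push.
rewrite /= !modnMDl !modn_small// => -[eq_rank].
exact/enum_rank_inj/val_inj.
Qed.

Lemma code_rcons w x : code (rcons w x) = code_push (code w) x.
Proof. exact: foldl_rcons. Qed.

Lemma code_inj : injective code.
Proof.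
elim/last_ind=> [|v x IHv] w; case/lastP: w => [|w y] //.
- by rewrite code_rcons => def0; have := code_push_gt (code w) y; rewrite -def0.
- by rewrite code_rcons => def0; have := code_push_gt (code v) x; rewrite def0.
by rewrite !code_rcons => /code_push_inj[/IHv-> ->].
Qed.

End Code.

Section Hnn.
Variables (I : finType) (C : groupType).
Local Notation F := (freeg I).
Variable alpha : bool -> {multiplicative C -> F}.
Hypothesis alpha_inj : forall e, injective (alpha e).
Implicit Types (e : bool) (f g r : F) (c : C).

(** * Shortlex-least coset representatives *)

Definition fcode f := code (fseq f).

Lemma fcode_inj : injective fcode.
Proof. by move=> f g /code_inj/fseq_inj. Qed.

(** Either [x] is appended to [f], and pushing a digit is monotone, or [x] cancels the last letter
    of [f], and the code even drops. The right-hand word is a plain concatenation, reduced or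
    not. *)
Lemma fcode_mull f g x :
  (fcode f < fcode g)%N ->
  (fcode (f * fletter x)%g < code (rcons (fseq g) x))%N.
Proof.
rewrite code_rcons /fcode.
have -> : fseq (f * fletter x) = red (rcons (fseq f) x).
  by rewrite fseq_mul fseq_letter cats1.
move: (fseq f) (fseq_reduced f) => v v_red.
case/lastP: v v_red => [|w y].
  by move=> _; apply: code_push_mono.
have [->|ny] := eqVneq y (linv x) => wy_red lt_fg.
  have -> : red (rcons (rcons w (linv x)) x) = w.
    rewrite -!cats1 -catA red_cat /= linvK eqxx -[foldr _ _ _]/(red w).
    by rewrite red_id//; move: wy_red; rewrite /= -cats1 => /reduced_catl.
  rewrite (leq_ltn_trans _ (code_push_gt _ _))// ltnW// (ltn_trans _ lt_fg)//.
  by rewrite code_rcons code_push_gt.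
rewrite red_id ?code_rcons; first by rewrite -code_rcons; apply: code_push_mono.
rewrite -cats1; apply: reduced_cat => //=; rewrite andbT.
by apply: contraNneq ny => ->; rewrite linvK.
Qed.

(** Codes are natural numbers, so the coset of [f] modulo the image of [alpha e] has a least
    element. The representative and its coordinate in [C] are paired so that one choice fixes
    both. *)
Lemma rep_ex e f : exists rc : F * C,
  f = alpha e rc.2 * rc.1 /\
  forall c', (fcode rc.1 <= fcode (alpha e c' * f)%g)%N.
Proof.
pose p n := `[< exists c, fcode (alpha e c * f) = n >].
have p_ex : exists n, p n.
  by exists (fcode (alpha e 1 * f)); apply/asboolP; exists 1.
case: (ex_minnP p_ex) => m /asboolP[c <-] m_min.
exists (alpha e c * f, c^-1); rewrite /= homV mulKg; split=> // c'.
by apply: m_min; apply/asboolP; exists c'.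
Qed.

Definition rep e f : F := (projT1 (cid (rep_ex e f))).1.

Definition corr e f : C := (projT1 (cid (rep_ex e f))).2.

Lemma rep_corr e f : f = alpha e (corr e f) * rep e f.
Proof. by rewrite /corr /rep; case: cid => rc []. Qed.

Lemma rep_min e f c : (fcode (rep e f) <= fcode (alpha e c * f)%g)%N.
Proof. by rewrite /rep; case: cid => rc [_ ->]. Qed.

Lemma repE e f : rep e f = alpha e (corr e f)^-1 * f.
Proof. by rewrite {3}(rep_corr e f) homV mulKg. Qed.

Lemma rep_mull e c f : rep e (alpha e c * f) = rep e f.
Proof.
apply: fcode_inj; apply/eqP; rewrite eqn_leq; apply/andP; split.
  by rewrite (repE e f) -(mulgVK c (corr e f)^-1) gmulfM -mulgA; exact: rep_min.
by rewrite (repE e (_ * _)) mulgA -gmulfM rep_min.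
Qed.

Lemma rep_idem e f : rep e (rep e f) = rep e f.
Proof. by rewrite {1}(repE e f) rep_mull. Qed.

Lemma rep1 e : rep e 1 = 1.
Proof.
apply: fcode_inj; apply/eqP; rewrite -leqn0.
by rewrite (leq_trans (rep_min _ _ 1))// hom1 mulg1.
Qed.

Lemma rep_alpha e c : rep e (alpha e c) = 1.
Proof. by rewrite -[alpha e c]mulg1 rep_mull rep1. Qed.

Lemma rep_eq1 e f : rep e f = 1 -> f = alpha e (corr e f).
Proof. by move=> rf1; rewrite {1}(rep_corr e f) rf1 mulg1. Qed.

Lemma rep_mulr e f g : rep e (rep e f * g) = rep e (f * g).
Proof. by rewrite {2}(rep_corr e f) -mulgA rep_mull. Qed.

(** The cocycle identity of the transversal: [f * g] and [rep e f * g] have the same representative,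
    which can be cancelled. It makes [hact] an action. *)
Lemma corr_mulr e f g : corr e (f * g) = corr e f * corr e (rep e f * g).
Proof.
apply: (@alpha_inj e); apply: (@mulIg _ (rep e (f * g))).
rewrite -rep_corr gmulfM -[in RHS](rep_mulr e f g) -mulgA -rep_corr mulgA.
by rewrite -rep_corr.
Qed.

Lemma corr_rep e f : corr e (rep e f) = 1.
Proof.
apply: (@alpha_inj e); apply: (@mulIg _ (rep e (rep e f))).
by rewrite -rep_corr rep_idem hom1 mul1g.
Qed.

Lemma corr_alpha e c : corr e (alpha e c) = c.
Proof.
by apply: (@alpha_inj e); rewrite {2}(rep_corr e (alpha e c)) rep_alpha mulg1.
Qed.

(** The Schreier property: if the coset of [w] had a smaller element, multiplying that element by
    [x] would give, by [fcode_mull], an element of the coset of [r] smaller than [r]. *)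
Lemma rep_prefix e r w x :
  rep e r = r -> fseq r = rcons w x -> rep e (fword w) = fword w.
Proof.
move=> r_rep def_r.
have w_red : reduced w.
  by apply: (@reduced_catl _ _ [:: x]); rewrite cats1 -def_r fseq_reduced.
have def_w : fseq (fword w) = w by rewrite fseq_fword red_id.
have r_w : r = fword w * fletter x by rewrite -fword_rcons -def_r fwordP.
apply: fcode_inj; apply/eqP; rewrite eqn_leq; apply/andP; split.
  by rewrite -[X in (_ <= fcode X)%N]mul1g -(hom1 (alpha e)) rep_min.
rewrite leqNgt; apply/negP => /(fcode_mull x); rewrite def_w -def_r.
rewrite -[code _]/(fcode r) ltnNge => /negP; apply.
by rewrite (repE e (fword w)) -mulgA -r_w -[X in (fcode X <= _)%N]r_rep rep_min.
Qed.

(** * HNN normal forms and the right action on them *)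

(* [Base f] stands for the element [f], and [Stab s e r] for [s t r] if [e] is
   true and [s t^-1 r] otherwise, where [t] is the stable letter, subject to
   [t (alpha true c) = (alpha false c) t]. *)
Inductive hnf := Base of F | Stab of hnf & bool & F.

Implicit Type s : hnf.

(** A pinch in the sense of Britton's lemma: in a valid form the tail [r] is a representative, hence
    lies in the associated subgroup only if it is 1. *)
Definition pinch s e :=
  if s is Stab _ e' r then (e' == ~~ e) && (r == 1) else false.

Fixpoint valid s :=
  if s is Stab s' e r then [/\ valid s', rep e r = r & ~~ pinch s' e] else True.

(** Write [r * f] as [u * r'] with [r'] its representative; [u] crosses the stable letter, becomes
    an element of the other subgroup, and acts on the shorter form. *)
Fixpoint hact s f := match s with
  | Base g => Base (g * f)
  | Stab s' e r =>
    Stab (hact s' (alpha (~~ e) (corr e (r * f)))) e (rep e (r * f))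
  end.

Definition htop s e :=
  if pinch s e then (if s is Stab s' _ _ then s' else s) else Stab s e 1.

Lemma hactM s f g : hact (hact s f) g = hact s (f * g).
Proof.
elim: s f g => [h|s IHs e r] f g /=; first by rewrite mulgA.
by rewrite IHs -gmulfM rep_mulr mulgA [in RHS]corr_mulr.
Qed.

Lemma hact1 s : valid s -> hact s 1 = s.
Proof.
elim: s => [h|s IHs e r] /=; first by rewrite mulg1.
by case=> /IHs s1 r_rep _; rewrite mulg1 -{1}r_rep corr_rep hom1 s1 r_rep.
Qed.

(** Right multiplication by an element of the subgroup does not change whether the tail belongs to
    that subgroup. *)
Lemma pinch_hact s e c :
  valid s -> pinch (hact s (alpha (~~ e) c)) e = pinch s e.
Proof.
case: s => //= s e' r [_ r_rep _]; case: eqP => //= def_e; subst e'.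
apply/eqP/eqP => [|->]; last by rewrite mul1g rep_alpha.
move/rep_eq1; set c' := corr _ _ => def_r.
rewrite -r_rep (_ : r = alpha (~~ e) (c' / c)) ?rep_alpha//.
by rewrite gmulfM homV -def_r mulgK.
Qed.

Lemma valid_hact s f : valid s -> valid (hact s f).
Proof.
elim: s f => //= s IHs e r f [s_val r_rep sNp]; split.
- exact: IHs.
- exact: rep_idem.
by rewrite pinch_hact.
Qed.

Lemma valid_htop s e : valid s -> valid (htop s e).
Proof.
rewrite /htop; case: ifPn => [|sNp s_val /=]; last by rewrite rep1.
by case: s => //= s e' r _ [].
Qed.

(** If the first letter removes a pinch, validity of [s] forbids the second letter to meet another
    one, so it restores what was removed. *)
Lemma htopK s e : valid s -> htop (htop s e) (~~ e) = s.
Proof.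
move=> s_val; rewrite {2}/htop; case: ifPn => [|sNp]; last first.
  by rewrite /htop /= negbK !eqxx.
case: s s_val => //= s e' r [_ _ sNp] /andP[/eqP def_e /eqP->].
by rewrite /htop -def_e (negPf sNp).
Qed.

Lemma htop_hact s e c :
  valid s -> hact (htop s e) (alpha e c) = htop (hact s (alpha (~~ e) c)) e.
Proof.
move=> s_val; rewrite /htop pinch_hact//; case: ifPn => [|_]; last first.
  by rewrite /= mul1g corr_alpha rep_alpha.
case: s s_val => //= s e' r _ /andP[/eqP-> /eqP->].
by rewrite negbK mul1g corr_alpha.
Qed.

(** * The rewriting rules and confluence *)

Local Notation X := ((I * bool) + bool)%type.
Implicit Types (a : X) (u v : seq X) (w : seq (I * bool)).

Definition xinv a : X :=
  match a with inl x => inl (linv x) | inr e => inr (~~ e) end.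

Definition lift w : seq X := map inl w.

(* The representatives form a prefix-closed (Schreier) transversal; an edge of
   the coset graph is recorded here when it lies outside the corresponding
   spanning tree. *)
Definition edge (p : bool * F * (I * bool)) : Prop :=
  let: (e, r, x) := p in
  [/\ rep e r = r, reduced (rcons (fseq r) x) &
      fseq (rep e (r * fletter x)) <> rcons (fseq r) x].

Definition edge_rule (p : bool * F * (I * bool)) : seq X * seq X :=
  let: (e, r, x) := p in
  (inr e :: lift (rcons (fseq r) x),
   lift (fseq (alpha (~~ e) (corr e (r * fletter x)))) ++
     inr e :: lift (fseq (rep e (r * fletter x)))).

Definition cancel_rule a : seq X * seq X := ([:: a; xinv a], [::]).

Definition hnn_rules : set (seq X * seq X) :=
  (range cancel_rule `|` edge_rule @` edge)%classic.

Local Notation steps := (rw_steps hnn_rules).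

Lemma rule_step u v : hnn_rules (u, v) -> steps u v.
Proof.
by move=> uv; apply: rt_step; exists [::], u, v, [::]; rewrite !cats0.
Qed.

Lemma steps_ctx u1 u2 u v : steps u v -> steps (u1 ++ u ++ u2) (u1 ++ v ++ u2).
Proof.
elim=> {u v} [_ _ [v1 [u [v [v2 [Ruv -> ->]]]]]|u|u v w _ uv _ vw].
- by apply: rt_step; exists (u1 ++ v1), u, v, (v2 ++ u2); rewrite !catA.
- exact: rt_refl.
- exact: rt_trans uv vw.
Qed.

Lemma steps_catl u1 u v : steps u v -> steps (u1 ++ u) (u1 ++ v).
Proof. by move=> /(steps_ctx u1 [::]); rewrite !cats0. Qed.

Lemma steps_catr u2 u v : steps u v -> steps (u ++ u2) (v ++ u2).
Proof. exact: (@steps_ctx [::]). Qed.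

Lemma steps_cancel a u : steps [:: a, xinv a & u] u.
Proof.
by apply: (@steps_catr u [:: _; _] [::]); apply: rule_step; left; exists a.
Qed.

Lemma steps_red w : steps (lift w) (lift (red w)).
Proof.
elim: w => [|x w IHw]; first exact: rt_refl.
apply: (rt_trans _ _ _ (inl x :: lift (red w))).
  exact: (steps_catl [:: _]).
rewrite [red (x :: w)]/=; case: (red w) => [|y v] /=; first exact: rt_refl.
case: eqP => [->|_]; [exact: steps_cancel|exact: rt_refl].
Qed.

Fixpoint spell s : seq X := match s with
  | Base f => lift (fseq f)
  | Stab s' e r => spell s' ++ inr e :: lift (fseq r)
  end.

(** Induction on [s]. The element [f] is arbitrary so that the induction hypothesis can be applied
    after each letter of a word which an edge rule sends to the left. *)
Lemma spell_letter s f x : valid s ->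
  steps (rcons (spell (hact s f)) (inl x)) (spell (hact s (f * fletter x))).
Proof.
elim: s f x => [g|s IHs e r] f x.
  move=> _; rewrite /hact mulgA /spell [fseq (_ * fletter x)]fseq_mul.
  by rewrite fseq_letter -cats1 /lift -(map_cat _ _ [:: x]); apply: steps_red.
move=> /[dup] /(valid_hact f) /=.
set g := alpha _ _; set r' := rep e (r * f).
case=> _ r'_rep _ [s_val _ _].
have sg_val := valid_hact g s_val.
(* The induction hypothesis, extended from letters to words. *)
have IHw w : steps (spell (hact s g) ++ lift w) (spell (hact s (g * fword w))).
  elim/last_ind: w => [|w y IHw].
    by rewrite cats0 (_ : fword _ = 1)// mulg1; apply: rt_refl.
  rewrite /lift map_rcons -rcons_cat fword_rcons mulgA.
  apply: rt_trans (IHs _ y s_val); rewrite -!cats1; exact: steps_catr.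
rewrite -cats1 -catA /= -/(lift _).
have -> : lift (fseq r') ++ [:: inl x] = lift (rcons (fseq r') x).
  by rewrite /lift map_rcons cats1.
rewrite mulgA -rep_mulr corr_mulr gmulfM -/r' -/g -hactM.
(* If [r' x] is not reduced, [x] cancels the last letter of [r']; what remains is a representative
   by the Schreier property, so a single cancellation suffices. *)
have [r'x_red|] := boolP (reduced (rcons (fseq r') x)); last first.
  case/lastP def_r' : (fseq r') => [|w y] //; rewrite -cats1 => /negP wyx_nred.
  have def_y : y = linv x.
    apply: contra_notP wyx_nred => ny; apply: reduced_cat.
      by rewrite -def_r' fseq_reduced.
    by rewrite /= andbT; apply/eqP => def_x; apply: ny; rewrite def_x linvK.
  have def_r'x : r' * fletter x = fword w.
    rewrite -(fwordP r') def_r' fword_rcons def_y fletterV -mulgA mulVg.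
    by rewrite mulg1.
  have w_rep := rep_prefix r'_rep def_r'.
  have w_red : reduced w.
    by apply: (@reduced_catl _ _ [:: y]); rewrite cats1 -def_r' fseq_reduced.
  rewrite def_r'x w_rep -{1}w_rep corr_rep hom1 hact1//.
  rewrite fseq_fword (red_id w_red); apply: steps_catl.
  rewrite -!cats1 -catA /lift map_cat def_y -[X in steps _ X]cats0.
  apply: (@steps_catl (inr e :: lift w)).
  have := steps_cancel (inl (linv x)) [::].
  by rewrite /= linvK.
have fseq_r'x : fseq (r' * fletter x) = rcons (fseq r') x.
  by rewrite fseq_mul fseq_letter cats1 red_id.
set q := rep e (r' * fletter x).
(* Along an edge of the spanning tree the word is already spelled correctly; any other edge has its
   own rule. *)
have [q_r'x|qNr'x] := eqVneq (fseq q) (rcons (fseq r') x).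
  have def_q : r' * fletter x = q by apply: fseq_inj; rewrite fseq_r'x.
  have q_rep : rep e q = q by apply: rep_idem.
  by rewrite q_r'x def_q -q_rep corr_rep hom1 hact1//; apply: rt_refl.
pose v := lift (fseq (alpha (~~ e) (corr e (r' * fletter x)))).
apply: (rt_trans _ _ _ (spell (hact s g) ++ v ++ inr e :: lift (fseq q))).
  apply/steps_catl/rule_step; right; exists (e, r', x) => //=.
  by split=> //; apply/eqP.
rewrite catA; apply: steps_catr.
by rewrite hactM -[X in hact _ (_ * X)]fwordP; apply: IHw.
Qed.

Definition hletter s a := match a with
  | inl x => hact s (fletter x)
  | inr e => htop s e
  end.

Lemma valid_hletter s a : valid s -> valid (hletter s a).
Proof. by case: a => [x|e]; [apply: valid_hact|apply: valid_htop]. Qed.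

Lemma valid_foldl s u : valid s -> valid (foldl hletter s u).
Proof. by elim: u s => //= a u IHu s /valid_hletter-/(_ a)/IHu. Qed.

Lemma foldl_lift s w : valid s -> foldl hletter s (lift w) = hact s (fword w).
Proof.
move=> s_val; elim/last_ind: w => [|w x IHw].
  by rewrite (_ : fword _ = 1)// hact1.
by rewrite /lift map_rcons foldl_rcons IHw /= hactM -fword_rcons.
Qed.

Lemma spell_hletter s a : valid s ->
  steps (rcons (spell s) a) (spell (hletter s a)).
Proof.
case: a => [x|e] s_val /=.
  by rewrite -{1}(hact1 s_val) -[fletter x]mul1g; apply: spell_letter.
rewrite /htop; case: ifPn => [|_]; last by rewrite /= cats1; apply: rt_refl.
case: s s_val => //= s e' r _ /andP[/eqP-> /eqP->].
rewrite /= -cats1 -catA -[X in steps _ X]cats0; apply: steps_catl.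
by rewrite -{2}[e]negbK; apply: steps_cancel.
Qed.

Definition hstate u := foldl hletter (Base 1) u.

Lemma valid_hstate u : valid (hstate u).
Proof. exact: valid_foldl. Qed.

Lemma steps_spell u : steps u (spell (hstate u)).
Proof.
elim/last_ind: u => [|u a IHu]; first exact: rt_refl.
rewrite /hstate foldl_rcons -cats1.
apply: rt_trans (spell_hletter a (valid_hstate u)).
by rewrite -cats1; apply: steps_catr.
Qed.

Lemma foldl_rule s u v :
  hnn_rules (u, v) -> valid s -> foldl hletter s u = foldl hletter s v.
Proof.
move=> Ruv s_val; case: Ruv => [[a _ [<- <-]]|[[[e r] x] _ [<- <-]]] /=.
  case: a => [x|e] /=; last exact: htopK.
  by rewrite hactM fletterV mulgV hact1.
have st_val := valid_htop e s_val.
rewrite foldl_cat /= !foldl_lift//; last exact/valid_htop/valid_hact.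
by rewrite !fwordP fword_rcons fwordP -htop_hact// hactM -rep_corr.
Qed.

Lemma hstate_congr u v : rw_congr hnn_rules u v -> hstate u = hstate v.
Proof.
elim=> {u v} [_ _ [v1 [u [v [v2 [Ruv -> ->]]]]]|//|//|u v w _ -> _ -> //].
by rewrite /hstate !foldl_cat (foldl_rule Ruv)//; apply: valid_hstate.
Qed.

Lemma steps_congr u v : steps u v -> rw_congr hnn_rules u v.
Proof.
elim=> {u v} [u v|u|u v w _ uv _ vw]; [exact: rst_step|exact: rst_refl|].
exact: rst_trans uv vw.
Qed.

Lemma hstateP u v : hstate u = hstate v <-> rw_congr hnn_rules u v.
Proof.
split=> [eq_uv|]; last exact: hstate_congr.
apply: (rst_trans _ _ _ (spell (hstate u))).
  exact/steps_congr/steps_spell.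
by rewrite eq_uv; apply/rst_sym/steps_congr/steps_spell.
Qed.

Lemma hnn_confluent : rw_confluent hnn_rules.
Proof.
move=> u v w uv uw; exists (spell (hstate u)).
  by rewrite (hstate_congr (steps_congr uv)); apply: steps_spell.
by rewrite (hstate_congr (steps_congr uw)); apply: steps_spell.
Qed.

(** * Finiteness of the set of rules *)

(** With [q] the representative of [r x], the word [r x q^-1] spells an element of the subgroup and
    begins with [r]. It is reduced: if [q] were [q' x], then [q'] would be a representative in the
    coset of [r], hence [r] itself, and the edge would lie in the tree. *)
Lemma edge_prefix e r x : edge (e, r, x) ->
  exists c i, r = rep e (fword (take i (fseq (alpha e c)))).
Proof.
case=> r_rep rx_red rxNrep.
exists (corr e (r * fletter x)), (size (fseq r)).
have fseq_rx : fseq (r * fletter x) = rcons (fseq r) x.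
  by rewrite fseq_mul fseq_letter cats1 red_id.
have -> : alpha e (corr e (r * fletter x)) =
    (r * fletter x) / rep e (r * fletter x).
  by rewrite [X in X / _](rep_corr e) mulgK.
rewrite fseq_mul fseq_inv fseq_rx red_id; last first.
  apply: reduced_cat => //.
  have := winv_reduced (fseq_reduced (rep e (r * fletter x))).
  case/lastP def_q: (fseq _) => [//|q y].
  rewrite /winv map_rcons rev_rcons /= => ->; rewrite andbT.
  rewrite (inj_eq (can_inj (@linvK _))); apply/eqP => def_y; subst y.
  have q_rep := rep_prefix (rep_idem e _) def_q.
  have def_rx : rep e (r * fletter x) = fword q * fletter x.
    by rewrite -fword_rcons -def_q fwordP.
  have def_r : r = fword q.
    rewrite -q_rep -{1}r_rep -[X in rep e X = _](mulgK (fletter x)).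
    by rewrite -rep_mulr def_rx mulgK.
  apply: rxNrep; rewrite def_q def_r fseq_fword red_id//.
  by apply: (@reduced_catl _ _ [:: x]); rewrite cats1 -def_q fseq_reduced.
by rewrite -cats1 -catA take_size_cat// fwordP.
Qed.

Section Finite.
Hypothesis C_fg : finitely_generated C.

(** Up to left multiplication by the subgroup, a prefix of a product is a prefix of one of the
    factors, and a prefix of an inverse [x^-1] is a prefix of [x]. Hence the prefixes of the
    generators suffice. *)
Lemma prefix_bound e : exists T : seq F, forall c i,
  rep e (fword (take i (fseq (alpha e c)))) \in T.
Proof.
have [gens gensP] := C_fg.
pose prefixes c :=
  [seq rep e (fword (take i (fseq (alpha e c))))
     | i <- iota 0 (size (fseq (alpha e c))).+1].
exists (1 :: flatten (map prefixes gens)).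
apply: gensP => [i|x y IHx IHy i|x IHx i|x x_gen i].
- rewrite hom1 fseq_one /= (_ : fword _ = 1)// rep1.
  exact: mem_head.
- rewrite gmulfM fseq_mul.
  have [j /eq_fword->] := take_red (fseq (alpha e x) ++ fseq (alpha e y)) i.
  rewrite take_cat; case: ifP => _ //.
  by rewrite fword_cat fwordP rep_mull.
- rewrite homV fseq_inv; set u := fseq _.
  have def_u : u = winv (drop i (winv u)) ++ winv (take i (winv u)).
    by rewrite -winv_cat cat_take_drop winvK.
  have := IHx (size (drop i (winv u))); rewrite -/u.
  rewrite [X in take _ X]def_u take_size_cat; last first.
    by rewrite /winv size_rev size_map.
  have -> : fword (take i (winv u)) =
      alpha e x^-1 * fword (winv (drop i (winv u))).
    rewrite homV -[alpha e x]fwordP -/u [X in (fword X)^-1]def_u fword_cat.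
    have fwordV w : fword (winv w) = (fword w)^-1.
      by apply/esym/mulg1_eq; rewrite -fword_cat; apply/fseq_inj/red_winvr.
    by rewrite fwordV invgM fwordV invgK -mulgA mulVg mulg1.
  by rewrite rep_mull.
rewrite in_cons; apply/orP; right; apply/flattenP.
exists (prefixes x); first exact: map_f.
(* Beyond the length of the word every prefix is the whole word, so [i] can be capped. *)
apply/mapP; exists (minn i (size (fseq (alpha e x)))).
  by rewrite mem_iota add0n /= ltnS geq_minr.
by rewrite take_min take_size.
Qed.

Lemma hnn_rules_finite : finite_set hnn_rules.
Proof.
rewrite finite_setU; split; first exact/finite_image/finite_finset.
apply: finite_image.
have [T TP] := prefix_bound true; have [T' T'P] := prefix_bound false.
pose sources := [seq (e, r) | e <- [:: true; false], r <- T ++ T'].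
pose edges := [seq (p, x) | p <- sources, x <- enum {: I * bool}].
apply: (sub_finite_set _ (finite_seq edges)).
case=> [[e r] x] /edge_prefix[c [i def_r]] /=.
apply: allpairs_f; last by rewrite mem_enum.
have r_T : r \in T ++ T'.
  by rewrite mem_cat def_r; case: (e); rewrite ?TP ?T'P ?orbT.
by case: e {def_r}; rewrite !mem_cat map_f ?orbT.
Qed.

End Finite.

(** * Termination *)

(* The block code of a word lists the codes of its maximal stable-letter-free
   factors, last factor first: every rule makes this list smaller, by length
   and then lexicographically. *)
Definition block (p : nat * seq nat) a : nat * seq nat := match a with
  | inl x => (code_push p.1 x, p.2)
  | inr _ => (0%N, p.1 :: p.2)
  end.

Fixpoint lexlt (k l : seq nat) : bool :=
  match k, l with
  | m :: k', n :: l' => (m < n)%N || (m == n) && lexlt k' l'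
  | _, _ => false
  end.

Definition blocklt (p q : nat * seq nat) : bool :=
  (size p.2 < size q.2)%N ||
  (size p.2 == size q.2) && lexlt (p.1 :: p.2) (q.1 :: q.2).

(** Fixing the length is what makes the lexicographic order well-founded; the induction is on the
    length, then the head, then the accessible tail. *)
Lemma lexlt_acc (l : seq nat) : Acc (fun k l => size k = size l /\ lexlt k l) l.
Proof.
have [n] := ubnP (size l); elim: n l => [l|n IHn]; first by rewrite ltn0.
case=> [|m l] /=; first by move=> _; split=> -[|? ?] [].
rewrite ltnS; elim/ltn_ind: m l => m IHm l lt_ln.
have acc_l := IHn l lt_ln; elim: acc_l lt_ln => {}l _ IHl lt_ln.
split=> -[[] //|m' k] [[eq_sz] /= /orP[lt_m|/andP[/eqP-> lt_k]]].
  by apply: IHm lt_m _ _; rewrite eq_sz.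
by apply: IHl; rewrite ?eq_sz.
Qed.

Lemma blocklt_acc p : Acc blocklt p.
Proof.
have [n] := ubnP (size p.2); elim: n p => [p|n IHn [m l] /=].
  by rewrite ltn0.
rewrite ltnS leq_eqVlt => /orP[/eqP sz_l|]; last exact: (IHn (m, l)).
have [k def_k] : {k | k = m :: l} by exists (m :: l).
elim: (lexlt_acc k) m l sz_l def_k => {}k _ IHk m l sz_l def_k.
split=> -[m' l'] /orP[/=|/andP[/eqP/= eq_sz lt_l]].
  rewrite sz_l; exact: (IHn (m', l')).
apply: (IHk (m' :: l')); [|by rewrite eq_sz|exact: erefl].
by rewrite def_k /= eq_sz.
Qed.

Lemma block_mono p q a : blocklt p q -> blocklt (block p a) (block q a).
Proof.
case: p q => [m k] [n l]; rewrite /blocklt; case: a => [x|e] /=; last first.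
  by rewrite ltnS eqSS.
case: ltngtP => //= _ /orP[/code_push_mono->//|/andP[/eqP-> ->]].
by rewrite eqxx orbT.
Qed.

Lemma foldl_block_mono p q u :
  blocklt p q -> blocklt (foldl block p u) (foldl block q u).
Proof. by elim: u p q => //= a u IHu p q /block_mono-/(_ a)/IHu. Qed.

Lemma foldl_block_lift p w :
  foldl block p (lift w) = (foldl (@code_push _) p.1 w, p.2).
Proof. by elim: w p => [[] //|x w IHw p] /=; rewrite IHw. Qed.

(** The state [p] stands for an arbitrary left context. Cancelling stable letters shortens the list,
    cancelling other letters lowers the current code, and an edge rule lowers the last factor, which
    is compared before the factor that may grow. *)
Lemma rule_blocklt p u v :
  hnn_rules (u, v) -> blocklt (foldl block p v) (foldl block p u).
Proof.
case: p => m l [[a _ [<- <-]]|[[[e r] x] [r_rep rx_red rxNrep] [<- <-]]].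
  rewrite /blocklt; case: a => [x|e] /=; last by rewrite ltnS leqnSn.
  by rewrite eqxx (ltn_trans (code_push_gt m x) (code_push_gt _ _)) orbT.
rewrite foldl_cat foldl_block_lift /= !foldl_block_lift /blocklt /= eqxx.
rewrite (_ : (_ < foldl _ _ _)%N) ?orbT// -/(code _) -/(code _).
(* The codes differ because the edge is outside the tree; the inequality is minimality of the
   representative. *)
rewrite ltn_neqAle (inj_eq (@code_inj _)); apply/andP; split; first exact/eqP.
have := rep_min e (r * fletter x) 1; rewrite hom1 mul1g /fcode.
by rewrite [X in (_ <= code X)%N]fseq_mul fseq_letter cats1 red_id.
Qed.

Lemma hnn_terminating : rw_terminating hnn_rules.
Proof.
case=> chain chainP; pose mu n := foldl block (0%N, [::]) (chain n).
have mu_lt n : blocklt (mu n.+1) (mu n).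
  have [v1 [u [v [v2 [Ruv def_n def_n1]]]]] := chainP n.
  rewrite /mu def_n def_n1 !foldl_cat.
  exact/foldl_block_mono/rule_blocklt.
have [p def_p] : {p | p = mu 0%N} by exists (mu 0%N).
elim: (blocklt_acc p) 0%N def_p => {}p _ IHp n def_p.
by apply: (IHp (mu n.+1)) (erefl _); rewrite def_p.
Qed.

Lemma hnn_complete : rw_complete hnn_rules.
Proof. split; [exact: hnn_terminating|exact: hnn_confluent]. Qed.

(** * The group presented by the rules *)

Definition hnn_group : Type := presented_monoid hnn_rules.

HB.instance Definition _ := Monoid.on hnn_group.

Implicit Types (m : hnn_group).

Definition hclass u : hnn_group := pm_class hnn_rules u.

Lemma hclass_cat u v : hclass (u ++ v) = hclass u * hclass v.
Proof. exact/esym/pm_mul_class. Qed.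

Lemma hclassP m : hclass (repr m) = m.
Proof. exact: pm_reprK. Qed.

Lemma hclass_congr u v : rw_congr hnn_rules u v -> hclass u = hclass v.
Proof. by move/pm_classP. Qed.

Lemma xinvK : involutive xinv.
Proof. by case=> [x|e] /=; rewrite ?linvK ?negbK. Qed.

Definition xwinv u := rev (map xinv u).

Lemma xwinvK : involutive xwinv.
Proof. by move=> u; rewrite /xwinv map_rev revK mapK//; apply: xinvK. Qed.

Lemma hclass_xwinvr u : hclass u * hclass (xwinv u) = 1.
Proof.
rewrite -hclass_cat; apply: hclass_congr; elim: u => [|a u IHu].
  exact: rst_refl.
rewrite /xwinv map_cons rev_cons -cats1 cat_cons catA -cat1s.
apply: rst_trans (rw_congr_ctx [:: a] [:: xinv a] IHu) _.
exact/steps_congr/steps_cancel.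
Qed.

Definition hinv m : hnn_group := hclass (xwinv (repr m)).

Lemma hmulrV : right_inverse 1 hinv *%g.
Proof. by move=> m; rewrite -{1}(hclassP m) hclass_xwinvr. Qed.

Lemma hmulVr : left_inverse 1 hinv *%g.
Proof.
move=> m; rewrite -[X in _ * X = _](hclassP m) /hinv.
by rewrite -[X in _ * hclass X]xwinvK hclass_xwinvr.
Qed.

HB.instance Definition _ := hasInv.Build hnn_group hinv.
HB.instance Definition _ := Monoid_isGroup.Build hnn_group hmulVr hmulrV.

Definition hbase f : hnn_group := hclass (lift (fseq f)).

Lemma hclass_lift w : hclass (lift w) = hbase (fword w).
Proof. exact/hclass_congr/steps_congr/steps_red. Qed.

Lemma hbaseM : {morph hbase : f g / f * g}.
Proof.
move=> f g; have -> : hbase f * hbase g = hclass (lift (fseq f ++ fseq g)).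
  by rewrite -hclass_cat /lift map_cat.
by rewrite hclass_lift fword_cat !fwordP.
Qed.

HB.instance Definition _ := isMultiplicative.Build F hnn_group hbase hbaseM.

Definition hstable : hnn_group := hclass [:: inr true].

Lemma hstable_rel c :
  hstable * hbase (alpha true c) = hbase (alpha false c) * hstable.
Proof.
rewrite /hstable /hbase -!hclass_cat; apply/hclass_congr/hstateP.
rewrite /hstate !foldl_cat !foldl_lift//; last exact: (valid_foldl [:: _]).
rewrite !fwordP /=.
exact: (@htop_hact (Base 1) true).
Qed.

(** * Evaluation of the presented group in another group *)

Section Eval.
Variables (P : groupType) (phi : {multiplicative F -> P}) (t : P).
Hypothesis t_rel : forall c, t * phi (alpha true c) = phi (alpha false c) * t.

Definition xeval a : P := match a with
  | inl x => phi (fletter x)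
  | inr e => if e then t else t^-1
  end.

Definition xweval u : P := foldr (fun a p => xeval a * p) 1 u.

Lemma xweval_cat u v : xweval (u ++ v) = xweval u * xweval v.
Proof. by elim: u => /= [|a u ->]; rewrite ?mul1g ?mulgA. Qed.

Lemma xweval_lift w : xweval (lift w) = phi (fword w).
Proof.
elim: w => /= [|x w ->]; first by rewrite (_ : fword _ = 1)// hom1.
by rewrite -cat1s fword_cat gmulfM.
Qed.

Lemma xeval_rel e c :
  xeval (inr e) * phi (alpha e c) = phi (alpha (~~ e) c) * xeval (inr e).
Proof.
case: e => //=; apply: (mulgI t); rewrite mulVKg mulgA t_rel.
by rewrite -mulgA mulgV mulg1.
Qed.

Lemma xweval_rule u v : hnn_rules (u, v) -> xweval u = xweval v.
Proof.
case=> [[a _ [<- <-]]|[[[e r] x] _ [<- <-]]].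
  case: a => [x|[]] /=; rewrite mulg1 ?mulgV ?mulVg//.
  by rewrite fletterV homV mulgV.
rewrite xweval_cat -/(lift _) [xweval (_ :: _)]/= [in RHS]/= !xweval_lift.
rewrite fword_rcons !fwordP mulgA -xeval_rel -mulgA -gmulfM.
by rewrite -rep_corr.
Qed.

Lemma xweval_congr u v : rw_congr hnn_rules u v -> xweval u = xweval v.
Proof.
elim=> {u v} [_ _ [v1 [u [v [v2 [Ruv -> ->]]]]]|//|//|u v w _ -> _ -> //].
by rewrite !xweval_cat (xweval_rule Ruv).
Qed.

Definition heval m : P := xweval (repr m).

Lemma heval_class u : heval (hclass u) = xweval u.
Proof. exact/xweval_congr/pm_repr_class. Qed.

Lemma hevalM : {morph heval : m n / m * n}.
Proof.
move=> m n; rewrite -(hclassP m) -(hclassP n) -hclass_cat !heval_class.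
exact: xweval_cat.
Qed.

HB.instance Definition _ := isMultiplicative.Build hnn_group P heval hevalM.

Lemma heval_base f : heval (hbase f) = phi f.
Proof. by rewrite heval_class xweval_lift fwordP. Qed.

Lemma heval_stable : heval hstable = t.
Proof. by rewrite heval_class /= mulg1. Qed.

(** [heval] and [psi] are mutually inverse: one composite is computed letter by letter on a
    representing word, the other fixes [phi] and [t] and is the identity by the last hypothesis. *)
Lemma hnn_admits_rewriting (psi : {multiplicative P -> hnn_group}) :
    finitely_generated C ->
    psi \o phi =1 hbase -> psi t = hstable ->
    (forall h : {multiplicative P -> P},
       h \o phi =1 phi -> h t = t -> h =1 id) ->
  admits_finite_complete_rewriting P.
Proof.
move=> C_fg psi_base psi_t P_gen.
exists X, hnn_rules; split; [exact: hnn_rules_finite|exact: hnn_complete|].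
exists heval; split; first by split; [exact: (hom1 heval)|exact: hevalM].
exists psi => [m|]; last first.
  apply: (P_gen (heval \o psi)) => [f|] /=; last by rewrite psi_t heval_stable.
  by rewrite -[psi _]/((psi \o phi) f) psi_base heval_base.
rewrite -(hclassP m) heval_class; elim: (repr m) => [|a u IHu].
  exact: hom1.
rewrite [xweval _]/= gmulfM {}IHu -cat1s hclass_cat; congr (_ * _).
case: a => [x|[]] /=.
- rewrite -[psi _]/((psi \o phi) _) psi_base -[[:: inl x]]/(lift [:: x]).
  by rewrite hclass_lift.
- exact: psi_t.
by rewrite homV psi_t; apply: mulg1_eq; apply: (hclass_xwinvr [:: inr true]).
Qed.

End Eval.

End Hnn.

(** * Homomorphisms from the integers and from free groups *)

Definition conjl (H : groupType) (t x : H) : H := t * x / t.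

Lemma conjlM (H : groupType) (t : H) : {morph conjl t : x y / x * y}.
Proof. by move=> x y; rewrite /conjl !mulgA mulgVK. Qed.

HB.instance Definition _ (H : groupType) (t : H) :=
  isMultiplicative.Build H H (conjl t) (conjlM t).

Section IntHom.
Local Notation Z := (Algebra.to_multiplicative int).
Variable H : groupType.

Definition zpow (t : H) (n : Z) : H :=
  match n with Posz k => t ^+ k | Negz k => t ^- k.+1 end.

Lemma zpow_succ (t : H) (n : int) : zpow t (n + 1)%R = zpow t n * t.
Proof.
case: n => k; first by rewrite -PoszD addn1 /= expgSr.
rewrite NegzE intS GRing.opprD GRing.addrAC GRing.addNr GRing.add0r.
have -> : (- 1 - k%:Z)%R = Negz k by rewrite NegzE intS GRing.opprD.
case: k => [|k]; first by rewrite /= mulVg.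
by rewrite -NegzE [RHS]/= [in RHS]expgS invgM mulgVK.
Qed.

Lemma zpowM (t : H) : {morph zpow t : m n / m * n}.
Proof.
have zpow_pred (n : int) : zpow t (n - 1)%R = zpow t n / t.
  by apply/(canRL (mulgK t)); rewrite -zpow_succ GRing.subrK.
suff zpowD (m n : int) : zpow t (m + n)%R = zpow t m * zpow t n by exact: zpowD.
elim/int_rect: n => [|n IHn|n IHn]; first by rewrite GRing.addr0 mulg1.
  by rewrite -addn1 PoszD GRing.addrA !zpow_succ IHn mulgA.
by rewrite -addn1 PoszD GRing.opprD GRing.addrA !zpow_pred IHn mulgA.
Qed.

HB.instance Definition _ (t : H) :=
  isMultiplicative.Build Z H (zpow t) (zpowM t).

Lemma eq_int_hom (h h' : {multiplicative Z -> H}) : h 1%R = h' 1%R -> h =1 h'.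
Proof.
move=> hh'.
have homD (k : {multiplicative Z -> H}) (m n : int) : k (m + n)%R = k m * k n.
  exact: (@gmulfM _ _ k m n).
have homN (k : {multiplicative Z -> H}) (n : int) : k (- n)%R = (k n)^-1.
  exact: (@homV _ _ k n).
elim/int_rect => [|n IHn|n IHn].
- by rewrite -[0%R](GRing.subrr 1%R) !homD !homN hh'.
- by rewrite intS !homD hh' IHn.
- by rewrite intS GRing.opprD !homD IHn !homN hh'.
Qed.

End IntHom.

Lemma eq_hom_basis (G H : groupType) (I : Type) (b : I -> G)
    (h h' : {multiplicative G -> H}) :
  is_basis b -> (forall i, h (b i) = h' (b i)) -> h =1 h'.
Proof.
move=> /(_ H (h' \o b))[k _ k_uniq] hh' x.
by rewrite (k_uniq h)// (k_uniq h').
Qed.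

(** Only finitely many basis elements occur in words for the generators. A map on these extends to
    the whole basis, and they determine a homomorphism since they generate. *)
Lemma finite_basis (A : groupType) :
  finitely_generated A -> is_free_group A ->
  exists n (b : 'I_n -> A), is_basis b.
Proof.
case=> gens gensP [I [b b_basis]].
(* The index type is arbitrary, whereas [freeg] compares letters. *)
pose J : choiceType := {classic I}.
have [h hb _] := b_basis (freeg J) (fun i => fletter (i : J, true)).
have hK : feval (b : J -> A) \o h =1 idfun.
  by apply: (eq_hom_basis b_basis) => i /=; rewrite hb feval_fletter.
pose js := undup (flatten [seq map fst (fseq (h a)) | a <- gens]).
pose b' (k : 'I_(size js)) : A := b (tnth (in_tuple js) k).
exists (size js), b' => H u.
(* Basis elements outside [js] may be sent anywhere; 1 is a convenient value. *)
pose u' (j : J) : H := if insub (index j js) is Some k then u k else 1.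
have [k kb _] := b_basis H u'.
exists k => [i|k' k'b'].
  rewrite kb /u' (tnth_nth (tnth (in_tuple js) i)) /= index_uniq ?undup_uniq//.
  by rewrite valK.
pose ev := weval (b : J -> A).
have k'k w : all (mem js) (map fst w) -> k' (ev w) = k (ev w).
  elim: w => [|[j c] w IHw] /=; first by rewrite !hom1.
  case/andP=> j_js /IHw; rewrite !gmulfM => ->; congr (_ * _).
  have k'kj : k' (b j) = k (b j).
    have /tnthP[i def_j] : j \in in_tuple js by [].
    rewrite [in LHS]def_j k'b' kb /u' def_j.
    rewrite (tnth_nth (tnth (in_tuple js) i)) /= index_uniq ?undup_uniq//.
    by rewrite valK.
  by case: c; rewrite /leval //= !homV k'kj.
apply: gensP => [|x y k'kx k'ky|x k'kx|x x_gen].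
- by rewrite !hom1.
- by rewrite !gmulfM k'kx k'ky.
- by rewrite !homV k'kx.
rewrite -[x]hK; apply: k'k; apply/allP => j j_x /=.
rewrite mem_undup; apply/flattenP; exists (map fst (fseq (h x))) => //.
exact: map_f.
Qed.

(** * The free product with the integers as an HNN extension *)

Theorem corollary1p2 (A B C G P : groupType)
    (f : {multiplicative C -> A}) (g : {multiplicative C -> B})
    (iA : {multiplicative A -> G}) (iB : {multiplicative B -> G})
    (jG : {multiplicative G -> P})
    (jZ : {multiplicative Algebra.to_multiplicative int -> P}) :
  finitely_generated A -> is_free_group A ->
  finitely_generated B -> is_free_group B ->
  finitely_generated C -> is_free_group C ->
  is_amalgam f g iA iB ->
  is_free_product jG jZ ->
  admits_finite_complete_rewriting P.
Proof.
move=> A_fg A_free B_fg B_free C_fg _ [f_inj g_inj iAB amalgamP] prodP.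
have [nA [bA bA_basis]] := finite_basis A_fg A_free.
have [nB [bB bB_basis]] := finite_basis B_fg B_free.
(* The free group on both bases together plays the role of [A * B]. *)
pose I : finType := ('I_nA + 'I_nB)%type.
have [jA jA_b _] := bA_basis (freeg I) (fun i => fletter (inl i, true)).
have [jB jB_b _] := bB_basis (freeg I) (fun i => fletter (inr i, true)).
have jA_inj : injective jA.
  (* Killing the basis of [B] gives a left inverse of [jA]. *)
  pose u (k : I) : A := if k is inl i then bA i else 1.
  apply: (@can_inj _ _ _ (feval u)).
  apply: (@eq_hom_basis _ _ _ _ (feval u \o jA) idfun bA_basis) => i /=.
  by rewrite jA_b feval_fletter.
have jB_inj : injective jB.
  pose u (k : I) : B := if k is inr i then bB i else 1.
  apply: (@can_inj _ _ _ (feval u)).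
  apply: (@eq_hom_basis _ _ _ _ (feval u \o jB) idfun bB_basis) => i /=.
  by rewrite jB_b feval_fletter.
pose alpha (e : bool) : {multiplicative C -> freeg I} :=
  if e then jA \o f : {multiplicative C -> freeg I} else jB \o g.
have alpha_inj e : injective (alpha e).
  by case: e; apply: inj_comp.
pose t : P := jZ 1%R.
(* Conjugating the copy of [B] by [t] turns the identification of [f c] with [g c] into the HNN
   relation. *)
pose u (k : I) : P :=
  match k with inl i => jG (iA (bA i)) | inr i => conjl t (jG (iB (bB i))) end.
have phi_A : feval u \o jA =1 jG \o iA.
  by apply: (eq_hom_basis bA_basis) => i /=; rewrite jA_b feval_fletter.
have phi_B : feval u \o jB =1 conjl t \o (jG \o iB).
  by apply: (eq_hom_basis bB_basis) => i /=; rewrite jB_b feval_fletter.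
have t_rel c : t * feval u (alpha true c) = feval u (alpha false c) * t.
  rewrite [feval u (alpha true c)]phi_A [feval u (alpha false c)]phi_B /=.
  by rewrite iAB /conjl mulgVK.
pose M := hnn_group alpha; pose s : M := hstable alpha.
pose vA : {multiplicative A -> M} := hbase alpha \o jA.
(* In the opposite direction the conjugation is undone, so that the two copies of [C] agree
   again. *)
pose vB : {multiplicative B -> M} := conjl s^-1 \o (hbase alpha \o jB).
have [|psiG [psiA psiB] _] := amalgamP M vA vB.
  move=> c; rewrite /= /conjl invgK -mulgA -(hstable_rel alpha_inj c).
  by rewrite mulKg.
have [psi [psi_G psi_Z] _] := prodP M psiG (zpow s).
have psi_t : psi t = s by rewrite psi_Z.
apply: (@hnn_admits_rewriting _ _ _ alpha_inj _ (feval u) t t_rel psi) => //.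
  apply: eq_hom_free => -[i|i] /=; rewrite feval_fletter /=.
    by rewrite psi_G psiA /= jA_b.
  rewrite /conjl !gmulfM homV psi_t psi_G psiB /= /conjl invgK jB_b.
  by rewrite !mulgA mulgV mul1g mulgK.
move=> h h_phi h_t.
have [k _ k_uniq] := prodP P jG jZ.
have h_Z : h \o jZ =1 jZ by apply: eq_int_hom.
have h_G : h \o jG =1 jG.
  (* A map fixing [t] and the image of the free group also fixes the unconjugated copy of [B], so
     both uniqueness clauses apply. *)
  have [l _ l_uniq] :=
    amalgamP P (jG \o iA) (jG \o iB) (fun c => congr1 jG (iAB c)).
  move=> x; rewrite (l_uniq (h \o jG))// ?(l_uniq jG)// => [a|b] /=.
    by rewrite -[jG _]phi_A; apply: h_phi.
  have -> : jG (iB b) = conjl t^-1 (feval u (jB b)).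
    by rewrite [feval u _]phi_B /= /conjl invgK !mulgA mulVg mul1g mulgVK.
  by rewrite /conjl !gmulfM !homV h_t [h (feval u _)]h_phi.
by move=> x; rewrite (k_uniq h)// -(k_uniq idfun).
Qed.
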